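(* Let $\mathcal S=(\mathcal U,\tilde\varphi,(\iota^{(i)})_{i\ge1})$ be a spreadability system for a $\mathcal B$-valued noncommutative probability space $(\mathcal A,\varphi)$, with partitioned cumulants $K_\pi$. A sequence of subalgebras $(\mathcal A_i)_{i\in I}$ of $\mathcal A$, where $I\subseteq\mathbb N$, is $\mathcal S$-independent if and only if for any $n\in\mathbb N$, any tuple $(i_1,\dots,i_n)\in I^n$, any $(X_1,\dots,X_n)\in\mathcal A_{i_1}\times\cdots\times\mathcal A_{i_n}$ and any $\pi\in\mathcal{OP}_n$, $$K_\pi(X_1,\dots,X_n)-\sum_{\tau\in\mathcal{OP}_n,\ \tau\le\pi}K_\tau(X_1,\dots,X_n)\,g(\tau,\kappa(i_1,\dots,i_n),\pi)=0 .$$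
   Context: Ordered set partitions. $\mathbb N=\{1,2,\dots\}$, $[n]=\{1,\dots,n\}$. An ordered set partition of $[n]$ is a sequence $\pi=(P_1,\dots,P_p)$ of pairwise disjoint nonempty blocks with union $[n]$; $|\pi|=p$; $\mathcal{OP}_n$ is the set of them; $\pi(i)$ denotes the index $k$ with $i\in P_k$; $\bar\pi$ is the underlying set partition; set partitions are ordered by refinement. For $\pi=(P_1,\dots,P_p)$, $\sigma=(S_1,\dots,S_s)$ we write $\pi\le\sigma$ iff $\bar\pi\le\bar\sigma$ and, whenever $i<j$, $P_i\subseteq S_k$, $P_j\subseteq S_l$, one has $k\le l$. The quasi-meet is $\pi\curlywedge\sigma=(P_1\cap S_1,P_1\cap S_2,\dots,P_1\cap S_s,P_2\cap S_1,\dots,P_p\cap S_s)$ with empty sets removed. The ordered kernel $\kappa(i_1,\dots,i_n)\in\mathcal{OP}_n$ has as blocks the level sets $\{k:i_k=v\}$ listed in increasing order of $v$. For $\sigma\le\pi$ and a block $P$ of $\pi$, $\#(\sigma\rfloor_P)$ is the number of blocks of $\sigma$ contained in $P$; $\widetilde\zeta(\sigma,\pi)=1/\prod_{P\in\pi}\#(\sigma\rfloor_P)!$ and $\widetilde\mu(\sigma,\pi)=(-1)^{|\sigma|-|\pi|}/\prod_{P\in\pi}\#(\sigma\rfloor_P)$. For $\tau,\eta,\pi\in\mathcal{OP}_n$ the partitioned Weisner and Goldberg coefficients are $$w(\tau,\eta,\pi)=\sum_{\sigma\in\mathcal{OP}_n,\ \sigma\curlywedge\eta=\tau,\ \sigma\le\pi}\widetilde\mu(\sigma,\pi),\qquad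 g(\tau,\eta,\pi)=\sum_{\sigma\in\mathcal{OP}_n,\ \sigma\ge\tau}\widetilde\zeta(\tau,\sigma)\,w(\sigma,\eta,\pi).$$ Spreadability systems. Algebras are associative over $\mathbb C$. A $\mathcal B$-valued noncommutative probability space is an algebra $\mathcal A$ with a linear map $\varphi:\mathcal A\to\mathcal B$ into an algebra $\mathcal B$. A spreadability system for it is a triple $(\mathcal U,\tilde\varphi,(\iota^{(i)})_{i\ge1})$ with $\mathcal U$ an algebra, $\tilde\varphi:\mathcal U\to\mathcal B$ linear, $\iota^{(i)}:\mathcal A\to\mathcal U$ homomorphisms with $\varphi=\tilde\varphi\circ\iota^{(i)}$, such that, writing $X^{(i)}=\iota^{(i)}(X)$, $\tilde\varphi(X_1^{(i_1)}\cdots X_n^{(i_n)})=\tilde\varphi(X_1^{(h(i_1))}\cdots X_n^{(h(i_n))})$ for all $X_k\in\mathcal A$, $i_k\in\mathbb N$ and all $h:\{i_1,\dots,i_n\}\to\mathbb N$ with $i_p<i_q\Rightarrow h(i_p)<h(i_q)$. For $\pi\in\mathcal{OP}_n$, $\varphi_\pi(X_1,\dots,X_n):=\tilde\varphi(X_1^{(i_1)}\cdots X_n^{(i_n)})$ for any indices with $\kappa(i_1,\dots,i_n)=\pi$; one extends $\varphi_\pi(X_1^{(i_1)},\dots,X_n^{(i_n)}):=\varphi_{\pi\curlywedge\kappa(i_1,\dots,i_n)}(X_1,\dots,X_n)$ and $\varphi_\pi(M_1.X_1,\dots,M_n.X_n):=\sum_{i_1=1}^{M_1}\cdots\sum_{i_n=1}^{M_n}\varphi_\pi(X_1^{(i_1)},\dots,X_n^{(i_n)})$.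 Cumulants. For $\pi\in\mathcal{OP}_n$ with $p$ blocks, $K_\pi(X_1,\dots,X_n)$ is the coefficient of $N_1\cdots N_p$ in the polynomial (in $N_1,\dots,N_p$) $\varphi_\pi(N_{\pi(1)}.X_1,\dots,N_{\pi(n)}.X_n)$; equivalently $K_\pi=\sum_{\sigma\le\pi}\widetilde\mu(\sigma,\pi)\varphi_\sigma$. $\mathcal S$-independence. A sequence $(\mathcal A_i)_{i\in I}$ ($I\subseteq\mathbb N$) of subalgebras of $\mathcal A$ is $\mathcal S$-independent if for any $n$, any $(i_1,\dots,i_n)\in I^n$, any $X_j\in\mathcal A_{i_j}$ and any $\pi\in\mathcal{OP}_n$ one has $\varphi_\pi(X_1,\dots,X_n)=\varphi_{\pi\curlywedge\kappa(i_1,\dots,i_n)}(X_1,\dots,X_n)$. *)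

(* Defs.v *)
From HB Require Import structures.
From mathcomp Require Import all_boot all_order all_algebra.
From mathcomp Require Import boolp classical_sets reals complex.
(* Last, so that [set0] and the like are those of finset. *)
From mathcomp Require Import finset.
Set Implicit Arguments.
Unset Strict Implicit.
Unset Printing Implicit Defensive.
Import Order.TTheory GRing.Theory Num.Theory.
Local Open Scope ring_scope.

(** * Ordered set partitions

    [n] is represented by 'I_n.  An ordered set partition is the sequence of
    its blocks, so blocks are numbered from 0 here. *)

Definition is_osp n (s : seq {set 'I_n}) : bool :=
  [&& set0 \notin s,
      pairwise (fun P Q : {set 'I_n} => [disjoint P & Q]) s
    & (\bigcup_(P <- s) P)%SET == [set: 'I_n]%SET].

Record osp (n : nat) : Type :=
  OSP { blocks :> seq {set 'I_n}; ospP : is_osp blocks }.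

HB.instance Definition _ n := [isSub for @blocks n].
HB.instance Definition _ n := [Choice of osp n by <:].

Lemma size_osp n (pi : osp n) : (size pi <= n)%N.
Proof.
case: pi => s /= /and3P[s0 sd _].
suff : (size s <= #|\bigcup_(P <- s) P|)%N.
  by move/leq_trans; apply; rewrite -[X in (_ <= X)%N]card_ord max_card.
elim: s s0 sd => [|P s IHs] //=.
rewrite inE negb_or eq_sym => /andP[P0 s0] /andP[Ps sd].
rewrite big_cons cardsU.
have -> : (P :&: \bigcup_(Q <- s) Q = set0)%SET.
  apply/eqP; rewrite setI_eq0; elim: s Ps {IHs s0 sd} => [|Q s IHs] /=.
    by rewrite big_nil disjoints_subset setC0 subsetT.
  case/andP=> PQ /IHs Ps.
  by rewrite big_cons -setI_eq0 setIUr setU_eq0 !setI_eq0 PQ.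
rewrite cards0 subn0 -add1n leq_add ?IHs //.
by rewrite card_gt0.
Qed.

Definition bseq_of_osp n (pi : osp n) : n.-bseq {set 'I_n} := Bseq (size_osp pi).
Definition osp_of_bseq n (s : n.-bseq {set 'I_n}) : option (osp n) :=
  insub (s : seq {set 'I_n}).

Lemma bseq_of_ospK n : pcancel (@bseq_of_osp n) (@osp_of_bseq n).
Proof. by move=> pi; rewrite /osp_of_bseq /= valK. Qed.

HB.instance Definition _ n := [Countable of osp n by <:].
HB.instance Definition _ n : isFinite (osp n) := PCanIsFinite (@bseq_of_ospK n).

Lemma osp_has n (pi : osp n) (k : 'I_n) : has (fun P : {set 'I_n} => k \in P) pi.
Proof.
case: pi => s /= /and3P[_ _ /eqP sT].
have : k \in (\bigcup_(P <- s) P)%SET by rewrite sT inE.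
elim: s {sT} => [|P s IHs] /=; first by rewrite big_nil inE.
by rewrite big_cons inE => /orP[->|/IHs->] //; rewrite orbT.
Qed.

Lemma osp_idx_subproof n (pi : osp n) (k : 'I_n) :
  (find (fun P : {set 'I_n} => k \in P) pi < size pi)%N.
Proof. by rewrite -has_find osp_has. Qed.

(** The 0-based index of the block of [pi] that contains [k], i.e. pi(k) - 1. *)
Definition osp_idx n (pi : osp n) (k : 'I_n) : 'I_(size pi) :=
  Ordinal (osp_idx_subproof pi k).

Definition osp_le n (pi sigma : osp n) : bool :=
  all (fun P : {set 'I_n} => has (fun S : {set 'I_n} => P \subset S) sigma) pi &&
  [forall i : 'I_(size pi), forall j : 'I_(size pi),
   forall k : 'I_(size sigma), forall l : 'I_(size sigma),
     [&& (i < j)%N, nth set0 pi i \subset nth set0 sigma k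
       & nth set0 pi j \subset nth set0 sigma l] ==> (k <= l)%N].

Definition qmeet_blocks n (pi sigma : seq {set 'I_n}) : seq {set 'I_n} :=
  [seq Q <- [seq (P :&: T)%SET | P <- pi, T <- sigma] | Q != set0].

Lemma bigcup_seqP n (s : seq {set 'I_n}) k :
  reflect (exists2 P, P \in s & k \in P) (k \in (\bigcup_(P <- s) P)%SET).
Proof.
elim: s => [|P s IHs]; first by rewrite big_nil inE; constructor => -[].
rewrite big_cons inE; apply: (iffP orP) => [[kP|/IHs[Q Qs kQ]]|[Q]].
- by exists P; rewrite ?mem_head.
- by exists Q; rewrite // inE Qs orbT.
rewrite inE => /predU1P[->|Qs] kQ; first by left.
by right; apply/IHs; exists Q.
Qed.

Lemma qmeet_subproof n (pi sigma : osp n) : is_osp (qmeet_blocks pi sigma).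
Proof.
case: pi sigma => s /= /and3P[s0 sd /eqP sT] [t /= /and3P[t0 td /eqP tT]].
apply/and3P; split.
- by rewrite mem_filter eqxx.
- apply: (subseq_pairwise (filter_subseq _ _)).
  elim: s sd {s0 sT} => [|P s IHs] //= /andP[Ps sd].
  rewrite pairwise_cat IHs // andbT; apply/andP; split.
    apply/allrelP => _ _ /mapP[S St ->] /allpairsP[[Q S'] /= [Qs _ ->]].
    apply: disjointWl (subsetIl _ _) _; apply: disjointWr (subsetIl _ _) _.
    exact: (allP Ps).
  rewrite pairwise_map; apply: sub_pairwise td => S S' /= SS'.
  apply: disjointWl (subsetIr _ _) _; exact: disjointWr (subsetIr _ _) _.
apply/eqP/setP => k; rewrite [RHS]inE; apply/bigcup_seqP.
have /bigcup_seqP[P Ps kP] : k \in (\bigcup_(P <- s) P)%SET by rewrite sT inE.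
have /bigcup_seqP[S St kS] : k \in (\bigcup_(P <- t) P)%SET by rewrite tT inE.
exists (P :&: S)%SET; last by rewrite inE kP.
rewrite mem_filter allpairs_f // andbT.
by apply/set0Pn; exists k; rewrite inE kP.
Qed.

Definition osp_qmeet n (pi sigma : osp n) : osp n :=
  OSP (qmeet_subproof pi sigma).

Definition okernel_values n (i : 'I_n -> nat) : seq nat :=
  sort leq (undup (codom i)).

Definition okernel_blocks n (i : 'I_n -> nat) : seq {set 'I_n} :=
  [seq [set k | i k == v]%SET | v <- okernel_values i].

Lemma okernel_subproof n (i : 'I_n -> nat) : is_osp (okernel_blocks i).
Proof.
apply/and3P; split.
- apply/mapP => -[v]; rewrite mem_sort mem_undup => /codomP[k ->] /setP/(_ k).
  by rewrite !inE eqxx.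
- rewrite pairwise_map.
  have : uniq (okernel_values i) by rewrite sort_uniq undup_uniq.
  rewrite uniq_pairwise; apply: sub_pairwise => u v /= uv.
  rewrite -setI_eq0; apply/eqP/setP => k; rewrite !inE.
  by apply/negP => /andP[/eqP ku /eqP kv]; rewrite -ku -kv eqxx in uv.
apply/eqP/setP => k; rewrite [RHS]inE; apply/bigcup_seqP.
exists [set l | i l == i k]%SET; last by rewrite inE.
by apply/mapP; exists (i k); rewrite // mem_sort mem_undup codom_f.
Qed.

Definition okernel n (i : 'I_n -> nat) : osp n := OSP (okernel_subproof i).

(** * Partitioned Weisner and Goldberg coefficients *)

Definition nblocks_in n (sigma : osp n) (P : {set 'I_n}) : nat :=
  count (fun S : {set 'I_n} => S \subset P) sigma.

(** [zeta] and [mu] are only meaningful, and only used, for [sigma <= pi];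
    in that case the truncated subtraction in the exponent is exact. *)
Definition zeta (F : fieldType) n (sigma pi : osp n) : F :=
  (\prod_(P <- pi) (nblocks_in sigma P)`!%:R)^-1.

Definition mu (F : fieldType) n (sigma pi : osp n) : F :=
  (-1) ^+ (size sigma - size pi) / \prod_(P <- pi) (nblocks_in sigma P)%:R.

Definition weisner (F : fieldType) n (tau eta pi : osp n) : F :=
  \sum_(sigma : osp n | (osp_qmeet sigma eta == tau) && osp_le sigma pi)
    mu F sigma pi.

Definition goldberg (F : fieldType) n (tau eta pi : osp n) : F :=
  \sum_(sigma : osp n | osp_le tau sigma) zeta F tau sigma * weisner F sigma eta pi.

(** * Associative algebras, not necessarily unital

    MathComp's [algType] requires a unit preserved by its morphisms, which is
    not assumed here. *)

HB.mixin Record Lmodule_isAssocAlg (F : fieldType) A of GRing.Lmodule F A := {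
  amul : A -> A -> A;
  amulA : associative amul;
  amulDl : left_distributive amul +%R;
  amulDr : right_distributive amul +%R;
  ascalerAl : forall (a : F) (x y : A), a *: amul x y = amul (a *: x) y;
  ascalerAr : forall (a : F) (x y : A), a *: amul x y = amul x (a *: y)
}.

#[short(type="assocAlgType")]
HB.structure Definition AssocAlg (F : fieldType) :=
  { A of GRing.Lmodule F A & Lmodule_isAssocAlg F A }.

(** [x_1 * ... * x_n] for [n >= 1]; the value 0 for [n = 0] is junk. *)
Definition aprod (F : fieldType) (A : assocAlgType F) n (x : 'I_n -> A) : A :=
  if [seq x k | k <- enum 'I_n] is y :: s then foldl amul y s else 0.

Definition is_subalgebra (F : fieldType) (A : assocAlgType F) (D : set A) : Prop :=
  [/\ D 0,
      forall (a : F) x y, D x -> D y -> D (a *: x + y)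
    & forall x y, D x -> D y -> D (amul x y)].

(** * Spreadability systems

    Indices range over the positive integers; [iota 0] is unconstrained and
    never used.  A map defined on the set of values of [i] is given by an
    arbitrary extension [h] to [nat]. *)

Record spreadability_system (F : fieldType) (A B : assocAlgType F)
    (phi : {linear A -> B}) := SpreadabilitySystem {
  spr_alg : assocAlgType F;
  spr_phi : {linear spr_alg -> B};
  spr_iota : nat -> A -> spr_alg;
  spr_iota_linear : forall i, (0 < i)%N -> linear (spr_iota i);
  spr_iota_mul : forall i, (0 < i)%N -> {morph spr_iota i : x y / amul x y};
  spr_phi_iota : forall i, (0 < i)%N -> forall x, phi x = spr_phi (spr_iota i x);
  spr_spread : forall n (X : 'I_n -> A) (i : 'I_n -> nat) (h : nat -> nat),
    (0 < n)%N ->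
    (forall k, (0 < i k)%N) -> (forall k, (0 < h (i k))%N) ->
    (forall p q, (i p < i q)%N -> (h (i p) < h (i q))%N) ->
    spr_phi (aprod (fun k => spr_iota (i k) (X k))) =
    spr_phi (aprod (fun k => spr_iota (h (i k)) (X k)))
}.

Section Cumulants.
Variables (F : fieldType) (A B : assocAlgType F) (phi : {linear A -> B}).
Variable S : spreadability_system phi.
Variable n : nat.
Implicit Types (pi : osp n) (X : 'I_n -> A).

(** The indices (pi(1), ..., pi(n)) are used; by [phi_ospE] any other indices
    with ordered kernel [pi] give the same value. *)
Definition phi_osp pi X : B :=
  spr_phi S (aprod (fun k => spr_iota S (osp_idx pi k).+1 (X k))).

Lemma phi_ospE (i : 'I_n -> nat) X : (0 < n)%N -> (forall k, (0 < i k)%N) ->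
  spr_phi S (aprod (fun k => spr_iota S (i k) (X k))) = phi_osp (okernel i) X.
Proof.
move=> n0 i0; set v := okernel_values i.
have vi k : i k \in v by rewrite mem_sort mem_undup codom_f.
have idxE k : osp_idx (okernel i) k = index (i k) v :> nat.
  rewrite /= /okernel_blocks find_map /index; apply: eq_find => u /=.
  by rewrite inE eq_sym.
have v_srt : sorted ltn v.
  by rewrite ltn_sorted_uniq_leq sort_uniq undup_uniq (sort_sorted leq_total).
rewrite (@spr_spread _ _ _ _ S n X i (fun u => (index u v).+1)) //.
  congr (spr_phi S (aprod _)); apply/funext => k; by rewrite -idxE.
move=> p q; rewrite ltnS => pq; rewrite ltnNge; apply/negP => qp.
move: pq; rewrite ltnNge => /negP; apply.
rewrite -(nth_index 0%N (vi p)) -(nth_index 0%N (vi q)).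
apply: (sorted_leq_nth leq_trans leqnn) => //; rewrite ?inE ?index_mem ?vi //.
exact: (sort_sorted leq_total).
Qed.

(** phi_pi (X_1^(i_1), ..., X_n^(i_n)) *)
Definition phi_copies pi (i : 'I_n -> nat) X : B :=
  phi_osp (osp_qmeet pi (okernel i)) X.

(** phi_pi (M_1.X_1, ..., M_n.X_n) *)
Definition phi_dot pi (M : 'I_n -> nat) X : B :=
  \sum_(i : {dffun forall k : 'I_n, 'I_(M k)})
    phi_copies pi (fun k => (i k : nat).+1) X.

(** [b] is the coefficient of N_1 ... N_p in [f], where [f] is a polynomial
    function of N_1, ..., N_p with coefficients [c m] in the module [V]. *)
Definition is_multilinear_coef (V : lmodType F) p (f : ('I_p -> nat) -> V)
    (b : V) : Prop :=
  exists d (c : {ffun 'I_p -> 'I_d.+2} -> V),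
    (forall N : 'I_p -> nat,
       f N = \sum_(m : {ffun 'I_p -> 'I_d.+2})
               (\prod_(k < p) (N k)%:R ^+ m k) *: c m) /\
    b = c [ffun=> inord 1].

(** K_pi (X_1, ..., X_n) *)
Definition cumulant pi X : B :=
  xget 0 (is_multilinear_coef
    (fun N : 'I_(size pi) -> nat => phi_dot pi (fun k => N (osp_idx pi k)) X)).

End Cumulants.

Definition spr_independent (F : fieldType) (A B : assocAlgType F)
    (phi : {linear A -> B}) (S : spreadability_system phi)
    (I : set nat) (D : nat -> set A) : Prop :=
  forall n, (0 < n)%N ->
  forall (i : 'I_n -> nat) (X : 'I_n -> A) (pi : osp n),
    (forall k, I (i k)) -> (forall k, D (i k) (X k)) ->
    phi_osp S pi X = phi_osp S (osp_qmeet pi (okernel i)) X.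

(* Main.v *)
Require Import Defs.
From HB Require Import structures.
From mathcomp Require Import all_boot all_order all_algebra.
From mathcomp Require Import boolp classical_sets reals complex.
From mathcomp Require Import finset.
From mathcomp Require Import zify.
Import GRing.Theory.
Local Open Scope ring_scope.

(** Fix the arguments X and put eta = okernel i.  Write phi_s for
    [phi_osp S s X] and K_s for [cumulant S s X].  Everything follows from two
    facts about ordered set partitions, valid over a field of characteristic 0:

    - K_pi is the sum of mu(s, pi) phi_s over s <= pi ([cumulantE]);
    - conversely phi_pi is the sum of zeta(s, pi) K_s over s <= pi
      ([moebius_inversion]).

    The second fact turns the sum of g(tau, eta, pi) K_tau over tau <= pi into
    the sum of w(s, eta, pi) phi_s over all s, and by definition of w this is
    the sum of mu(s, pi) phi_(s qmeet eta) over s <= pi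
    ([sum_goldberg_cumulant]).  Subtracting it from K_pi leaves

      sum over s <= pi of mu(s, pi) (phi_s - phi_(s qmeet eta)),

    which vanishes for all pi if and only if, by Moebius inversion again, all
    the differences phi_s - phi_(s qmeet eta) vanish ([cumulant_goldbergP]).
    The latter for all X and i is independence.

    Both facts come from one count.  An ordered set partition is the same thing
    as a total preorder on 'I_n: the relation <= is inclusion of preorders
    ([osp_leP]) and the quasi-meet is the lexicographic product
    ([qmeet_idx_le]).  If the values on the j-th block of pi are
    bounded by N_j, the number of functions i with pi qmeet (okernel i) = tau
    is 0 unless tau <= pi, and is then the product over the blocks of pi of
    C(N_j, k_j), where k_j is the number of blocks of tau inside the j-th block
    ([card_qmeet_ker]).

    This count makes phi_dot a polynomial in the N_j, whose multilinear
    coefficient is [cumulantE], because C(x, k) has linear coefficient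
    (-1)^(k-1) / k.  That the multilinear coefficient of a polynomial function
    is unique follows from the invertibility of Vandermonde matrices.

    For the inversion take all N_j equal to N, and let B(N) be the matrix of
    these counts, indexed by tau and pi.  Pairs of functions ordered
    lexicographically give B(N) B(M) = B(N M) ([refinementsM]).  As B is a
    polynomial in N, comparing coefficients shows that its coefficient
    matrices b_k satisfy b_j b_k = 0 for j != k and b_k b_k = b_k
    ([coef_refinement_polyM]).  Now for tau <= s <= pi the (tau, s) entry of B
    has degree |tau| with leading coefficient zeta(tau, s), and the (s, pi)
    entry has order |pi| with lowest coefficient mu(s, pi), so the (tau, pi) entry of b_|tau| b_|pi|
    is the (tau, pi) entry of zeta mu; it is 0 unless |tau| = |pi|, and under
    that condition tau <= pi only if tau = pi.  Hence zeta mu = 1, and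
    mu zeta = 1 because the matrices are square. *)

(** * Ordered set partitions as total preorders *)

Section OspPreorder.
Set Implicit Arguments.
Unset Strict Implicit.
Local Open Scope nat_scope.
Variable n : nat.
Implicit Types pi sigma tau eta : osp n.

Lemma mem_block pi (k : 'I_n) (j : nat) :
  (k \in nth set0 pi j) = (osp_idx pi k == j :> nat).
Proof.
apply/idP/eqP => [kj | <-]; last exact: (nth_find set0 (osp_has pi k)).
have jpi : j < size pi.
  by rewrite ltnNge; apply: contraTN kj => /(nth_default _)->; rewrite inE.
have kidx : k \in nth set0 pi (osp_idx pi k).
  exact: (nth_find set0 (osp_has pi k)).
have /and3P[_ dis _] := ospP pi.
have {}dis (a b : nat) : a < size pi -> b < size pi -> a < b ->
    ~~ ((k \in nth set0 pi a) && (k \in nth set0 pi b)).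
  move=> api bpi ab; apply/negP => /andP[ka kb].
  have /pred0P/(_ k) := pairwiseP set0 dis a b api bpi ab.
  by rewrite /= ka kb.
case: (ltngtP (osp_idx pi k) j) => // lt_kj.
- by have := dis _ _ (ltn_ord _) jpi lt_kj; rewrite kidx kj.
- by have := dis _ _ jpi (ltn_ord _) lt_kj; rewrite kidx kj.
Qed.

Lemma block_inhabited pi (j : 'I_(size pi)) : exists k, osp_idx pi k == j.
Proof.
have /and3P[pi0 _ _] := ospP pi.
have : nth set0 pi j != set0.
  by apply: contraNneq pi0 => <-; exact: mem_nth.
by case/set0Pn => k; rewrite mem_block => kj; exists k.
Qed.

Definition osp_rep pi (j : 'I_(size pi)) : 'I_n :=
  xchoose (block_inhabited j).

Lemma osp_repK pi (j : 'I_(size pi)) : osp_idx pi (osp_rep j) = j.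
Proof. exact: (eqP (xchooseP (block_inhabited j))). Qed.

(** The blockwise definition of the order says that the preorder of [tau] is
    contained in that of [sigma].  This is the form used from now on. *)
Lemma osp_leP tau sigma :
  reflect (forall k l, osp_idx tau k <= osp_idx tau l ->
             osp_idx sigma k <= osp_idx sigma l)
          (osp_le tau sigma).
Proof.
apply: (iffP idP) => [/andP[/allP sub_s /forallP ord_s] k l | le_ts].
- have sub_blk m :
      nth set0 tau (osp_idx tau m) \subset nth set0 sigma (osp_idx sigma m).
    have /hasP[Q Qs PQ] := sub_s _ (mem_nth set0 (ltn_ord (osp_idx tau m))).
    have: m \in Q by rewrite (fintype.subsetP PQ) // mem_block.
    by rewrite -{1}(nth_index set0 Qs) mem_block => /eqP->; rewrite nth_index.
  rewrite leq_eqVlt => /predU1P[kl | lt_kl].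
    have : l \in nth set0 tau (osp_idx tau k) by rewrite mem_block kl.
    by move/(fintype.subsetP (sub_blk k)); rewrite mem_block => /eqP->.
  have /forallP/(_ (osp_idx tau l))/forallP/(_ (osp_idx sigma k)) :=
    ord_s (osp_idx tau k).
  by move/forallP/(_ (osp_idx sigma l)); rewrite lt_kl !sub_blk.
have eq_s k l : osp_idx tau k = osp_idx tau l -> osp_idx sigma k = osp_idx sigma l.
  by move=> kl; apply/val_inj/eqP; rewrite eqn_leq !le_ts ?kl.
apply/andP; split.
  apply/(all_nthP set0) => a a_tau; pose k := osp_rep (Ordinal a_tau).
  apply/hasP; exists (nth set0 sigma (osp_idx sigma k)); first exact: mem_nth.
  apply/fintype.subsetP => l; rewrite !mem_block => /eqP la.
  by rewrite (eq_s l k) //; apply/val_inj; rewrite osp_repK.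
apply/forallP=> x; apply/forallP=> y; apply/forallP=> a; apply/forallP=> b.
apply/implyP => /and3P[ij /fintype.subsetP ia /fintype.subsetP jb].
have := ia (osp_rep x); rewrite !mem_block osp_repK eqxx => /(_ isT)/eqP<-.
have := jb (osp_rep y); rewrite !mem_block osp_repK eqxx => /(_ isT)/eqP<-.
by apply: le_ts; rewrite !osp_repK ltnW.
Qed.

Lemma osp_le_refl pi : osp_le pi pi.
Proof. exact/osp_leP. Qed.

Lemma osp_le_trans sigma tau pi :
  osp_le tau sigma -> osp_le sigma pi -> osp_le tau pi.
Proof.
by move=> /osp_leP ts /osp_leP sp; apply/osp_leP => k l /ts/sp.
Qed.

Lemma osp_le_eq_idx tau pi k l : osp_le tau pi ->
  osp_idx tau k = osp_idx tau l -> osp_idx pi k = osp_idx pi l.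
Proof.
by move=> /osp_leP le_tp kl; apply/val_inj/eqP; rewrite eqn_leq !le_tp ?kl.
Qed.

(** There is at least one block of [sigma] for each block of [tau] that precedes
    the one of [k]: induction on the position of [k]. *)
Lemma osp_le_idx tau sigma k :
  osp_le sigma tau -> osp_idx tau k <= osp_idx sigma k.
Proof.
move=> /osp_leP le_st; move: {2}(osp_idx tau k : nat) (erefl (osp_idx tau k : nat)) => m.
elim: m k => [|m IHm] k km; first by rewrite km.
have m_lt : m < size tau by rewrite -km ltnW // ltn_ord.
set l := osp_rep (Ordinal m_lt).
have lm : osp_idx tau l = m :> nat by rewrite osp_repK.
rewrite km -lm (leq_ltn_trans (IHm _ lm)) // ltnNge.
by apply/negP => /le_st; rewrite lm km ltnn.
Qed.

Lemma osp_le_anti tau sigma : osp_le tau sigma -> osp_le sigma tau -> tau = sigma.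
Proof.
move=> ts st; have eq_idx k : osp_idx tau k = osp_idx sigma k :> nat.
  by apply/eqP; rewrite eqn_leq !osp_le_idx.
have sub_sz (pi rho : osp n) : (forall k, osp_idx pi k = osp_idx rho k :> nat) ->
    size pi <= size rho.
  move=> eq_pr; rewrite leqNgt; apply/negP => lt_rp.
  by have := ltn_ord (osp_idx rho (osp_rep (Ordinal lt_rp))); rewrite -eq_pr osp_repK ltnn.
apply/val_inj/(@eq_from_nth _ set0).
  by apply/eqP; rewrite eqn_leq !sub_sz.
by move=> a _; apply/setP => k; rewrite !mem_block eq_idx.
Qed.

(** A preorder determines its ordered set partition; identities between
    quasi-meets thereby reduce to comparisons of natural numbers. *)
Lemma osp_eqP tau sigma :
  (forall k l, (osp_idx tau k <= osp_idx tau l) =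
               (osp_idx sigma k <= osp_idx sigma l)) <-> tau = sigma.
Proof.
split=> [eq_ts | -> //]; apply: osp_le_anti; apply/osp_leP => k l.
- by rewrite eq_ts.
- by rewrite eq_ts.
Qed.

Lemma leq_lex s a b c d : c < s -> d < s ->
  (a * s + c <= b * s + d) = (a < b) || (a == b) && (c <= d).
Proof.
move=> cs ds; case: (ltngtP a b) => [ab | ba | ->] /=; last by rewrite leq_add2l.
- by apply/idP; nia.
- by apply/negbTE; rewrite -ltnNge; nia.
Qed.

(** In the list of the P_i :&: S_j an element k lies at position
    pi(k) * size sigma + sigma(k), and removing the empty sets does not change
    the order of the positions. *)
Lemma qmeet_idx_le pi sigma k l :
  (osp_idx (osp_qmeet pi sigma) k <= osp_idx (osp_qmeet pi sigma) l) =
  (osp_idx pi k < osp_idx pi l) ||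
  (osp_idx pi k == osp_idx pi l) && (osp_idx sigma k <= osp_idx sigma l).
Proof.
pose pos (s : seq {set 'I_n}) m := find (fun P : {set 'I_n} => m \in P) s.
have pos_filter s : (pos [seq Q <- s | Q != set0] k <= pos [seq Q <- s | Q != set0] l)
    = (pos s k <= pos s l).
  elim: s => //= Q s IHs; case: eqP => [-> | _] /=; first by rewrite !inE ltnS.
  by case: (k \in Q); case: (l \in Q).
have pos_pairs s m : has (fun P : {set 'I_n} => m \in P) s ->
    pos [seq P :&: T | P <- s, T <- sigma]%SET m =
    pos s m * size sigma + osp_idx sigma m.
  elim: s => //= P s IHs; rewrite /pos find_cat has_map size_map.
  have [mP _ | mP /= /IHs IHm] /= := boolP (m \in P).
    have eq_m : preim (setI P) (fun P : {set 'I_n} => m \in P) =1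
        (fun P : {set 'I_n} => m \in P) by move=> T; rewrite /= inE mP.
    by rewrite (eq_has eq_m) osp_has find_map (eq_find eq_m).
  rewrite (@eq_has _ _ pred0) ?has_pred0 => [|T]; last by rewrite /= inE (negbTE mP).
  by rewrite mulSn -addnA -IHm.
have -> : (osp_idx (osp_qmeet pi sigma) k <= osp_idx (osp_qmeet pi sigma) l) =
    (pos (qmeet_blocks pi sigma) k <= pos (qmeet_blocks pi sigma) l) by [].
by rewrite pos_filter !pos_pairs ?osp_has // leq_lex.
Qed.

Lemma okernel_idx_le (i : 'I_n -> nat) k l :
  (osp_idx (okernel i) k <= osp_idx (okernel i) l) = (i k <= i l).
Proof.
set v := okernel_values i.
have vi m : i m \in v by rewrite mem_sort mem_undup codom_f.
have idxE m : osp_idx (okernel i) m = index (i m) v :> nat.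
  rewrite /= /okernel_blocks find_map /index; apply: eq_find => u /=.
  by rewrite inE eq_sym.
have v_srt : sorted ltn v.
  by rewrite ltn_sorted_uniq_leq sort_uniq undup_uniq (sort_sorted leq_total).
rewrite !idxE; apply/idP/idP; last first.
  rewrite (leqNgt (i k)) (leqNgt (index (i k) v)); apply: contra.
  exact: (sorted_ltn_index ltn_trans v_srt).
exact: (sorted_leq_index leq_trans leqnn (sort_sorted leq_total _)).
Qed.

Lemma osp_qmeet_lel pi eta : osp_le (osp_qmeet pi eta) pi.
Proof. by apply/osp_leP => k l; rewrite qmeet_idx_le => /orP[/ltnW|/andP[/eqP->]]. Qed.

End OspPreorder.

(** * Blocks of a refinement *)

Section BlockCounts.
Set Implicit Arguments.
Unset Strict Implicit.
Local Open Scope nat_scope.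
Variable n : nat.
Implicit Types pi sigma tau eta : osp n.

(** When [tau <= pi], the block of [pi] that contains the [a]-th block of [tau]. *)
Definition osp_over tau pi (a : 'I_(size tau)) : 'I_(size pi) :=
  osp_idx pi (osp_rep a).

Lemma osp_over_idx tau pi k :
  osp_le tau pi -> osp_over pi (osp_idx tau k) = osp_idx pi k.
Proof. by move=> le_tp; apply: (osp_le_eq_idx le_tp); rewrite osp_repK. Qed.

Lemma osp_over_surj tau pi (j : 'I_(size pi)) :
  osp_le tau pi -> exists a : 'I_(size tau), osp_over pi a = j.
Proof.
move=> le_tp; exists (osp_idx tau (osp_rep j)).
by rewrite osp_over_idx // osp_repK.
Qed.

Lemma nblocks_inE tau pi (j : 'I_(size pi)) : osp_le tau pi ->
  nblocks_in tau (nth set0 pi j) = #|[set a : 'I_(size tau) | osp_over pi a == j]|.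
Proof.
move=> le_tp; rewrite -sum1_card /nblocks_in -sum1_count.
rewrite (big_nth set0) big_mkord; apply: eq_bigl => a.
rewrite inE; apply/fintype.subsetP/eqP => [sub_a | <- k].
  apply/val_inj/eqP; rewrite -[_ == _]mem_block; apply: sub_a.
  by rewrite mem_block osp_repK.
rewrite !mem_block => /eqP ka; apply/eqP; congr (nat_of_ord _).
by apply: (osp_le_eq_idx le_tp); rewrite osp_repK; apply/val_inj.
Qed.

Lemma nblocks_in_gt0 tau pi (j : 'I_(size pi)) :
  osp_le tau pi -> 0 < nblocks_in tau (nth set0 pi j).
Proof.
move=> le_tp; rewrite nblocks_inE // card_gt0; apply/set0Pn.
by have [a aj] := osp_over_surj j le_tp; exists a; rewrite inE aj.
Qed.

Lemma sum_nblocks_in tau pi : osp_le tau pi ->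
  \sum_(j < size pi) nblocks_in tau (nth set0 pi j) = size tau.
Proof.
move=> le_tp; rewrite -[RHS]card_ord -sum1_card.
rewrite (partition_big (@osp_over tau pi) xpredT) //=.
apply: eq_bigr => j _; rewrite nblocks_inE // -sum1_card.
by apply: eq_bigl => a; rewrite inE.
Qed.

(** The counts are all positive and their sum is the number of blocks of [pi]. *)
Lemma nblocks_in_eq1 tau pi (j : 'I_(size pi)) :
  osp_le tau pi -> size tau = size pi -> nblocks_in tau (nth set0 pi j) = 1.
Proof.
move=> le_tp eq_sz.
have: \sum_(i < size pi) 1 == \sum_(i < size pi) nblocks_in tau (nth set0 pi i).
  by rewrite sum_nblocks_in // sum1_card card_ord eq_sz.
have [_ ->] := leqif_sum (fun i (_ : true) =>
  leqif_eq (nblocks_in_gt0 (i : 'I_(size pi)) le_tp)).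
by move/forall_inP/(_ j isT)/eqP.
Qed.

Lemma osp_le_size_eq tau pi : osp_le tau pi -> size tau = size pi -> tau = pi.
Proof.
move=> le_tp eq_sz; apply: (osp_le_anti le_tp).
apply/osp_leP => k l le_kl; rewrite leqNgt; apply/negP => lt_lk.
have eq_kl : osp_idx pi k = osp_idx pi l.
  apply/val_inj/eqP; rewrite eqn_leq le_kl.
  by move/osp_leP: le_tp; apply; exact: ltnW.
have /eqP := nblocks_in_eq1 (osp_idx pi k) le_tp eq_sz.
rewrite nblocks_inE // => /cards1P[a /setP fib_a].
have := fib_a (osp_idx tau l); have := fib_a (osp_idx tau k).
rewrite !inE !osp_over_idx // -eq_kl eqxx => /esym/eqP ka /esym/eqP la.
by rewrite ka la ltnn in lt_lk.
Qed.

Definition fibre_increasing (J : eqType) p (h : 'I_p -> J) (N : J -> nat)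
    (g : 'I_p -> nat) : bool :=
  [forall a, g a < N (h a)] &&
  [forall a : 'I_p, forall b : 'I_p, (a < b) && (h a == h b) ==> (g a < g b)].

Lemma sum_bin m k : \sum_(v < m) 'C(v, k) = 'C(m, k.+1).
Proof.
elim: m => [|m IHm]; first by rewrite big_ord0.
by rewrite big_ord_recr /= IHm binS.
Qed.

Lemma sum_ffun_recr p M (G : {ffun 'I_p.+1 -> 'I_M} -> nat) :
  \sum_g G g =
  \sum_(v < M) \sum_(g : {ffun 'I_p -> 'I_M})
     G [ffun a => if unlift ord_max a is Some b then g b else v].
Proof.
rewrite pair_big /=.
rewrite (reindex (fun vg : 'I_M * {ffun 'I_p -> 'I_M} =>
  [ffun a => if unlift ord_max a is Some b then vg.2 b else vg.1])) //=.
exists (fun g => (g ord_max, [ffun b => g (lift ord_max b)])) => [[v g] _ | g _].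
  congr (_, _); first by rewrite ffunE unlift_none.
  by apply/ffunP => b; rewrite !ffunE liftK.
by apply/ffunP => a; rewrite ffunE; case: unliftP => [b ->|->] //=; rewrite ffunE.
Qed.

(** Induction on the number of points.  Once the value [v] of the last point is
    fixed, the other points of its fibre are bounded by [v] instead of by [N],
    so the count is a sum over [v] of binomial coefficients.  This is why the
    bound [N] has to vary with the fibre. *)
Lemma card_fibre_increasing (J : finType) p (h : 'I_p -> J) (N : J -> nat) M :
  (forall j, N j <= M) ->
  #|[set g : {ffun 'I_p -> 'I_M} | fibre_increasing h N (fun a => g a)]| =
  \prod_j 'C(N j, #|[set a | h a == j]|).
Proof.
move=> NM; rewrite -sum1dep_card big_mkcond /=.
elim: p h N NM => [|p IHp] h N NM.
  rewrite (eq_bigr (fun=> 1)) => [|g _]; last first.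
    rewrite ifT //; apply/andP; split; apply/forallP => -[] //.
  rewrite sum1_card card_ffun !card_ord expn0 big1 // => j _.
  by rewrite (_ : [set a | _] = set0) ?cards0 ?bin0 //; apply/setP => -[].
rewrite sum_ffun_recr; set t := h ord_max.
pose h' b := h (lift ord_max b).
(* The bounds left for the other points once the last one takes the value [v]. *)
pose upd v j := if j == t then v else N j.
transitivity (\sum_(v < M | v < N t) \prod_j 'C(upd v j, #|[set a | h' a == j]|)).
  rewrite [RHS]big_mkcond; apply: eq_bigr => v _.
  case: ifP => vN; last first.
    rewrite big1 // => g _; rewrite ifN //; apply/negP => /andP[/forallP/(_ ord_max)].
    by rewrite ffunE unlift_none vN.
  rewrite -(IHp h' (upd v)) => [|j]; last first.
    by rewrite /upd; case: ifP => // _; exact: ltnW.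
  apply: eq_bigr => g _; congr (if _ then _ else _).
  apply/idP/idP => /andP[/forallP bnd /forallP incr].
    apply/andP; split; apply/forallP => a.
      have := bnd (lift ord_max a); have /forallP/(_ ord_max) := incr (lift ord_max a).
      rewrite !ffunE liftK unlift_none /upd -/t -/(h' a) lift_max ltn_ord /=.
      by case: ifP.
    apply/forallP => b; have /forallP/(_ (lift ord_max b)) := incr (lift ord_max a).
    by rewrite !ffunE !liftK !lift_max.
  apply/andP; split; apply/forallP => a; last apply/forallP => b; rewrite !ffunE.
    case: unliftP => [a' ->|-> //]; apply: leq_trans (bnd a') _.
    by rewrite /upd /h'; case: eqP => // ->; exact: ltnW.
  case: unliftP => [a' ->|->]; case: unliftP => [b' ->|->].
  - by have /forallP/(_ b') := incr a'; rewrite !lift_max.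
  - rewrite lift_max ltn_ord /=; apply/implyP => /eqP a't.
    by have := bnd a'; rewrite /upd /h' a't eqxx.
  - by rewrite lift_max ltnNge ltnW ?ltn_ord.
  - by rewrite ltnn.
have fib j : #|[set a | h a == j]| = #|[set a | h' a == j]| + (t == j).
  rewrite -!sum1_card big_mkcond big_ord_recr /= [in RHS]big_mkcond inE -/t.
  congr (_ + _).
  apply: eq_bigr => a _; rewrite !inE /h'; congr (if h _ == j then _ else _).
  by apply/val_inj; rewrite /= /bump leqNgt ltn_ord.
rewrite [RHS](bigD1 t) //= fib eqxx addn1 -sum_bin.
rewrite (big_ord_widen_cond M xpredT (fun v => 'C(v, #|[set a | h' a == t]|))) //.
rewrite big_distrl /=; apply: eq_bigr => v _.
rewrite (bigD1 t) //= {1}/upd eqxx; congr (_ * _); apply: eq_bigr => j jt.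
by rewrite fib eq_sym (negbTE jt) addn0 /upd (negbTE jt).
Qed.

End BlockCounts.

(** * Counting functions with prescribed quasi-meet *)

Section Counting.
Set Implicit Arguments.
Unset Strict Implicit.
Local Open Scope nat_scope.
Variable n : nat.
Implicit Types pi sigma tau eta : osp n.

Lemma qmeet_kerP pi tau (i : 'I_n -> nat) :
  reflect (forall k l, (osp_idx tau k <= osp_idx tau l) =
             (osp_idx pi k < osp_idx pi l) ||
             (osp_idx pi k == osp_idx pi l) && (i k <= i l))
          (osp_qmeet pi (okernel i) == tau).
Proof.
apply: (iffP eqP) => [<- k l | eq_tau]; first by rewrite qmeet_idx_le okernel_idx_le.
by apply/osp_eqP => k l; rewrite qmeet_idx_le okernel_idx_le eq_tau.
Qed.

Lemma qmeet_ker_block pi tau (i : 'I_n -> nat) k l :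
  osp_qmeet pi (okernel i) == tau -> osp_idx pi k = osp_idx pi l ->
  (osp_idx tau k <= osp_idx tau l) = (i k <= i l).
Proof. by move=> /qmeet_kerP-> ->; rewrite ltnn eqxx. Qed.

(** A function [i] with [osp_qmeet pi (okernel i) = tau] is constant on the blocks
    of [tau], hence a function of those blocks; the condition then says that it
    increases along the blocks of [tau] inside each block of [pi]. *)
Lemma card_qmeet_ker pi tau (N : 'I_(size pi) -> nat) :
  #|[set i : {dffun forall k : 'I_n, 'I_(N (osp_idx pi k))} |
      osp_qmeet pi (okernel (fun k => (i k : nat).+1)) == tau]| =
  if osp_le tau pi then \prod_j 'C(N j, nblocks_in tau (nth set0 pi j)) else 0.
Proof.
case: ifPn => [le_tp | nle_tp]; last first.
  apply/eqP; rewrite cards_eq0; apply/eqP/setP => i; rewrite !inE.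
  by apply/negbTE; apply: contraNneq nle_tp => <-; exact: osp_qmeet_lel.
pose M := \max_j N j; have NM j : N j <= M by exact: leq_bigmax.
under eq_bigr => j _ do rewrite nblocks_inE //.
rewrite -(card_fibre_increasing (@osp_over n tau pi) NM).
set D := [set i | _].
pose f (i : {dffun forall k : 'I_n, 'I_(N (osp_idx pi k))}) :=
  [ffun a : 'I_(size tau) => widen_ord (NM _) (i (osp_rep a))].
have D_const i k : i \in D -> f i (osp_idx tau k) = i k :> nat.
  rewrite inE ffunE => i_tau /=; set l := osp_rep _.
  have eq_lk : osp_idx pi l = osp_idx pi k.
    by apply: (osp_le_eq_idx le_tp); rewrite osp_repK.
  apply/eqP; rewrite eqn_leq -ltnS -(qmeet_ker_block i_tau eq_lk).
  by rewrite -[i k <= _]ltnS -(qmeet_ker_block i_tau (esym eq_lk)) osp_repK leqnn.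
have f_inj : {in D &, injective f}.
  move=> i i' Di Di' eq_f; apply/ffunP => k; apply/val_inj.
  by rewrite /= -!D_const // eq_f.
rewrite -(card_in_imset f_inj); apply: eq_card => g; rewrite [RHS]inE.
apply/imsetP/andP => [[i Di ->] | [/forallP bnd /forallP incr]].
  split; apply/forallP => a; first by rewrite ffunE; exact: (ltn_ord (i (osp_rep a))).
  apply/forallP => b; apply/implyP => /andP[ab /eqP eq_ab].
  move: Di; rewrite !ffunE inE /= ltnNge => i_tau.
  by rewrite -[_ <= _]ltnS -(qmeet_ker_block i_tau (esym eq_ab)) !osp_repK -ltnNge.
have bndI k : g (osp_idx tau k) < N (osp_idx pi k).
  by rewrite -(osp_over_idx k le_tp) bnd.
pose i := finfun (fun k => Ordinal (bndI k)) :
  {dffun forall k : 'I_n, 'I_(N (osp_idx pi k))}.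
exists i; last first.
  by apply/ffunP => a; apply/val_inj; rewrite !ffunE /= osp_repK.
have i_g k : i k = g (osp_idx tau k) :> nat by rewrite ffunE.
rewrite inE; apply/qmeet_kerP => k l; rewrite ltnS !i_g.
have incr_kl k' l' : osp_idx tau k' < osp_idx tau l' ->
    osp_idx pi k' = osp_idx pi l' -> g (osp_idx tau k') < g (osp_idx tau l').
  move=> lt_kl eq_kl; have /forallP/(_ (osp_idx tau l')) := incr (osp_idx tau k').
  by rewrite lt_kl !osp_over_idx // eq_kl eqxx.
have le_pi k' l' := (elimT (osp_leP tau pi) le_tp) k' l'.
case: (ltngtP (osp_idx tau k) (osp_idx tau l)) => [lt_kl | lt_lk | eq_kl].
- have := le_pi _ _ (ltnW lt_kl); rewrite leq_eqVlt.
  case/predU1P => [/val_inj eq_kl | -> //].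
  by rewrite eq_kl eqxx (ltnW (incr_kl _ _ lt_kl eq_kl)) orbT.
- have := le_pi _ _ (ltnW lt_lk); rewrite leq_eqVlt.
  case/predU1P => [/val_inj eq_kl | lt_pi].
    by rewrite eq_kl ltnn eqxx [RHS]leqNgt (incr_kl _ _ lt_lk eq_kl).
  by rewrite -val_eqE (gtn_eqF lt_pi) ltnNge (ltnW lt_pi).
- by rewrite (osp_le_eq_idx le_tp (val_inj eq_kl)) eqxx (val_inj eq_kl) leqnn orbT.
Qed.

(** The count of [card_qmeet_ker] with one bound [N] for all blocks, the matrix
    B(N) of the proof. *)
Definition refinements tau pi N : nat :=
  if osp_le tau pi then
    \prod_(j < size pi) 'C(N, nblocks_in tau (nth set0 pi j))
  else 0.

Lemma refinementsE tau pi N :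
  #|[set i : {ffun 'I_n -> 'I_N} | osp_qmeet pi (okernel (fun k => i k)) == tau]|
  = refinements tau pi N.
Proof.
rewrite /refinements.
have /= <- := card_qmeet_ker tau (fun _ : 'I_(size pi) => N).
apply: eq_card => i.
by rewrite !inE; apply/qmeet_kerP/qmeet_kerP.
Qed.

(** Expresses a lexicographic comparison by [<=] alone, so that
    [qmeet_idx_le] can rewrite the comparisons of an inner quasi-meet. *)
Lemma lex_leq (a b : nat) c :
  (a < b) || (a == b) && c = (a <= b) && ((b <= a) ==> c).
Proof. by case: ltngtP. Qed.

(** Both sides count the pairs (g, f) with
    (pi qmeet okernel g) qmeet okernel f = tau: on the left they are sorted by
    sigma = pi qmeet okernel g; on the right a pair is coded by the single
    function g * N + f, whose kernel is the iterated quasi-meet because the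
    coding is increasing for the lexicographic order. *)
Lemma refinementsM tau pi N M :
  \sum_sigma refinements tau sigma N * refinements sigma pi M =
  refinements tau pi (N * M).
Proof.
pose pair_ker (g : {ffun 'I_n -> 'I_M}) (f : {ffun 'I_n -> 'I_N}) :=
  osp_qmeet (osp_qmeet pi (okernel (fun k => g k))) (okernel (fun k => f k)).
transitivity (\sum_(g : {ffun 'I_n -> 'I_M}) \sum_(f : {ffun 'I_n -> 'I_N})
                (pair_ker g f == tau)).
  rewrite (partition_big (fun g : {ffun 'I_n -> 'I_M} =>
             osp_qmeet pi (okernel (fun k => g k))) xpredT) //=.
  apply: eq_bigr => sigma _.
  rewrite -[refinements sigma _ _]refinementsE -sum1dep_card big_distrr /=.
  apply: eq_bigr => g /eqP g_sigma; rewrite muln1 -refinementsE -sum1dep_card.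
  by rewrite [LHS]big_mkcond; apply: eq_bigr => f _; rewrite /pair_ker g_sigma.
rewrite pair_big /= -refinementsE -sum1dep_card [RHS]big_mkcond /=.
have enc_lt (g : 'I_M) (f : 'I_N) : g * N + f < N * M.
  by have := ltn_ord g; have := ltn_ord f; nia.
pose enc (gf : {ffun 'I_n -> 'I_M} * {ffun 'I_n -> 'I_N}) :=
  [ffun k => Ordinal (enc_lt (gf.1 k) (gf.2 k))].
have div_lt (h : 'I_(N * M)) : h %/ N < M.
  by rewrite ltn_divLR ?(mulnC M) //; have := ltn_ord h; nia.
have mod_lt (h : 'I_(N * M)) : h %% N < N.
  by rewrite ltn_mod; have := ltn_ord h; nia.
rewrite (reindex enc) /=; last first.
  exists (fun h : {ffun 'I_n -> 'I_(N * M)} =>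
    ([ffun k => Ordinal (div_lt (h k))], [ffun k => Ordinal (mod_lt (h k))])).
    move=> [g f] _; congr (_, _); apply/ffunP => k; apply/val_inj; rewrite !ffunE /=.
      by rewrite divnMDl ?divn_small ?addn0 //; have := ltn_ord (f k); lia.
    by rewrite modnMDl modn_small.
  by move=> h _; apply/ffunP => k; apply/val_inj; rewrite !ffunE /= -divn_eq.
apply: eq_bigr => -[g f] _ /=; rewrite (_ : _ == tau = (pair_ker g f == tau)).
  by case: (_ == _).
congr (_ == tau); apply/osp_eqP => k l.
rewrite [RHS]qmeet_idx_le -val_eqE lex_leq !qmeet_idx_le !okernel_idx_le.
rewrite -!val_eqE /= !ffunE /= leq_lex //.
by case: (ltngtP (find _ _) (find _ _)) => //= _; case: (ltngtP (g k) (g l)).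
Qed.

End Counting.

(** * Binomial polynomials and multilinear coefficients *)

Section Coefficients.
Set Implicit Arguments.
Unset Strict Implicit.
Variables (F : fieldType) (char0 : [pchar F] =i pred0).

Let natr_eq0 m : (m%:R == 0 :> F) = (m == 0%N) := (pcharf0P F).1 char0 m.

Lemma natr_inj_pchar0 : injective (fun m => m%:R : F).
Proof.
move=> a b; wlog le_ab : a b / (a <= b)%N => [hw /= eq_ab|/eqP].
  by case/orP: (leq_total a b) => /hw; [apply | move/(_ (esym eq_ab))].
rewrite eq_sym -subr_eq0 -natrB // natr_eq0 subn_eq0 => le_ba.
by apply/eqP; rewrite eqn_leq le_ab.
Qed.

Lemma poly_eq_on_nat (p q : {poly F}) :
  (forall m : nat, p.[m%:R] = q.[m%:R]) -> p = q.
Proof.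
move=> eq_pq; apply/eqP; rewrite -subr_eq0; apply: contraT => nz.
set rs := [seq m%:R : F | m <- iota 0 (size (p - q))].
have: (size rs < size (p - q)%R)%N.
  apply: max_poly_roots nz _ _; last first.
    by rewrite map_inj_uniq ?iota_uniq //; exact: natr_inj_pchar0.
  by apply/allP => _ /mapP[m _ ->]; rewrite /root !hornerE eq_pq subrr.
by rewrite size_map size_iota ltnn.
Qed.

Definition binomial_poly k : {poly F} := (k`!%:R)^-1 *: \prod_(i < k) ('X - i%:R%:P).

Lemma horner_binomial_poly k m : (binomial_poly k).[m%:R] = 'C(m, k)%:R.
Proof.
have -> : 'C(m, k)%:R = (k`!%:R)^-1 * (m ^_ k)%:R :> F.
  by rewrite -bin_ffact natrM mulrCA mulVf ?mulr1 // natr_eq0 -lt0n fact_gt0.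
rewrite hornerZ horner_prod; congr (_ * _).
elim: k => [|k IHk]; first by rewrite big_ord0.
rewrite big_ord_recr /= IHk ffactnSr natrM !hornerE.
have [km | mk] := leqP k m; first by rewrite natrB.
by rewrite ffact_small // !mul0r.
Qed.

Lemma size_binomial_poly k : size (binomial_poly k) = k.+1.
Proof.
rewrite size_scale ?size_prod_XsubC; last by rewrite invr_eq0 natr_eq0 -lt0n fact_gt0.
by rewrite /index_enum -enumT size_enum_ord.
Qed.

Lemma lead_coef_binomial_poly k : lead_coef (binomial_poly k) = (k`!%:R)^-1.
Proof. by rewrite lead_coefZ lead_coef_prod_XsubC mulr1. Qed.

(** Exhibits the lowest coefficient in a form stable under products. *)
Lemma binomial_poly_mulX k : (0 < k)%N ->
  exists2 q, binomial_poly k = 'X * q & q`_0 = (-1) ^+ k.-1 / k%:R.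
Proof.
case: k => // k _; exists ((k.+1`!%:R)^-1 *: \prod_(i < k) ('X - i.+1%:R%:P)).
  by rewrite /binomial_poly big_ord_recl subr0 -scalerAr.
rewrite coefZ coef0_prod.
under eq_bigr => i _ do rewrite coefB coefX coefC /= sub0r -mulN1r.
rewrite big_split /= prodr_const card_ord -natr_prod.
have -> : (\prod_(i < k) i.+1)%N = k`!.
  by rewrite fact_prod big_add1 /= big_mkord.
rewrite factS natrM invfM mulrACA mulVf ?natr_eq0 -?lt0n ?fact_gt0 //.
by rewrite mulr1 mulrC.
Qed.

(** Weights that read off the coefficient of x from the values at 0, ..., D - 1
    of any polynomial of degree less than D, including those with coefficients in
    a module. *)
Lemma extract_linear_coef D : exists a : 'I_D -> F,
  forall m, (m < D)%N -> \sum_j a j * j%:R ^+ m = (m == 1%N)%:R.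
Proof.
pose x : 'rV[F]_D := \row_j (j : nat)%:R.
have V_unit : Vandermonde D x \in unitmx.
  rewrite unitmxE det_Vandermonde unitfE; apply/prodf_neq0 => i _.
  apply/prodf_neq0 => j ij; rewrite !mxE subr_eq0.
  by apply: contraTneq ij => /natr_inj_pchar0->; rewrite ltnn.
pose e : 'cV[F]_D := \col_m (m == 1%N :> nat)%:R.
exists (fun j => (invmx (Vandermonde D x) *m e) j 0) => m mD.
have := congr1 (fun c : 'cV_D => c (Ordinal mD) 0) (mulKVmx V_unit e).
by rewrite !mxE => <-; apply: eq_bigr => j _; rewrite !mxE mulrC.
Qed.

(** Applying the weights of [extract_linear_coef] in each variable expresses the
    multilinear coefficient through the values of [f] alone. *)
Lemma multilinear_coef_uniq (V : lmodType F) p (f : ('I_p -> nat) -> V) b b' :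
  is_multilinear_coef f b -> is_multilinear_coef f b' -> b = b'.
Proof.
suff coefE D (a : 'I_D -> F) :
    (forall m, (m < D)%N -> \sum_j a j * j%:R ^+ m = (m == 1%N)%:R) ->
    forall d (c : {ffun 'I_p -> 'I_d.+2} -> V), (d.+2 <= D)%N ->
    (forall N : 'I_p -> nat, f N =
       \sum_(m : {ffun 'I_p -> 'I_d.+2}) (\prod_(k < p) (N k)%:R ^+ m k) *: c m) ->
    c [ffun=> inord 1] =
    \sum_(N : {ffun 'I_p -> 'I_D}) (\prod_k a (N k)) *: f (fun k => N k).
  move=> [d [c [fE ->]]] [d' [c' [fE' ->]]].
  have [a aP] := extract_linear_coef (maxn d d').+2.
  by rewrite (coefE _ _ aP _ c) ?(coefE _ _ aP _ c') // !ltnS ?leq_maxl ?leq_maxr.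
move=> aP d c dD fE.
under eq_bigr => N _ do rewrite fE scaler_sumr.
rewrite exchange_big /=.
have sumE (m : {ffun 'I_p -> 'I_d.+2}) :
    \sum_(N : {ffun 'I_p -> 'I_D})
      (\prod_k a (N k)) *: ((\prod_(k < p) (N k)%:R ^+ m k) *: c m) =
    (m == [ffun=> inord 1])%:R *: c m.
  under eq_bigr => N _ do rewrite scalerA -big_split /=.
  rewrite -scaler_suml -(bigA_distr_bigA (fun k (j : 'I_D) => a j * j%:R ^+ m k)).
  congr (_ *: _); under eq_bigr => k _ do rewrite aP ?(leq_trans (ltn_ord _)) //.
  have [-> | /eqP/ffunP m1] := eqVneq m.
    by rewrite big1 // => k _; rewrite ffunE inordK.
  apply/eqP; apply/negPn/negP => /prodf_neq0 nz; apply: m1 => k.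
  apply/val_inj; rewrite ffunE /= inordK //; apply/eqP.
  by have := nz k isT; case: (_ == 1%N); rewrite ?eqxx.
rewrite (eq_bigr _ (fun m _ => sumE m)) (bigD1 [ffun=> inord 1]) //= eqxx scale1r.
by rewrite big1 ?addr0 // => m /negbTE->; rewrite scale0r.
Qed.

End Coefficients.

(** * Moebius inversion *)

Section Moebius.
Set Implicit Arguments.
Unset Strict Implicit.
Variables (F : fieldType) (char0 : [pchar F] =i pred0) (n : nat).
Implicit Types pi sigma tau : osp n.

Definition refinement_poly tau pi : {poly F} :=
  if osp_le tau pi then
    \prod_(j < size pi) binomial_poly F (nblocks_in tau (nth set0 pi j))
  else 0.

Lemma horner_refinement_poly tau pi m :
  (refinement_poly tau pi).[m%:R] = (refinements tau pi m)%:R.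
Proof.
rewrite /refinement_poly /refinements; case: ifP => _; last by rewrite horner0.
by rewrite horner_prod natr_prod; apply: eq_bigr => j _; rewrite horner_binomial_poly.
Qed.

(** The identity B(N) B(M) = B(N M) holds for all natural N and M, hence as an
    identity of polynomials in two variables; compare coefficients in N first,
    then in M. *)
Lemma coef_refinement_polyM tau pi i j :
  \sum_sigma (refinement_poly tau sigma)`_i * (refinement_poly sigma pi)`_j =
  if i == j then (refinement_poly tau pi)`_j else 0.
Proof.
have mulE m : \sum_sigma (refinement_poly sigma pi).[m%:R] *: refinement_poly tau sigma =
    refinement_poly tau pi \Po (m%:R *: 'X).
  apply: (poly_eq_on_nat char0) => k; rewrite horner_sum horner_comp !hornerE.
  rewrite -natrM horner_refinement_poly mulnC -refinementsM natr_sum.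
  by apply: eq_bigr => sigma _; rewrite hornerZ !horner_refinement_poly natrM mulrC.
have coefE : \sum_sigma (refinement_poly tau sigma)`_i *: refinement_poly sigma pi =
    (refinement_poly tau pi)`_i *: 'X^i.
  apply: (poly_eq_on_nat char0) => m.
  have := congr1 (fun p : {poly F} => p`_i) (mulE m).
  rewrite coef_sum horner_sum hornerZ hornerXn => mE.
  transitivity (\sum_sigma
    ((refinement_poly sigma pi).[m%:R] *: refinement_poly tau sigma)`_i).
    by apply: eq_bigr => sigma _; rewrite hornerZ coefZ mulrC.
  rewrite mE coef_comp_poly.
  under eq_bigr => k _ do rewrite exprZn coefZ coefXn.
  have [i_lt | le_i] := ltnP i (size (refinement_poly tau pi)).
    rewrite (bigD1 (Ordinal i_lt)) //= eqxx mulr1 big1 ?addr0 // => k ki.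
    rewrite (_ : i == k = false) ?mulr0 //; apply: contra_neqF ki => /eqP ki.
    exact/val_inj.
  rewrite nth_default // mul0r big1 // => k _.
  by rewrite gtn_eqF ?mulr0 // (leq_trans (ltn_ord k)).
have := congr1 (fun p : {poly F} => p`_j) coefE.
rewrite coef_sum coefZ coefXn => jE.
transitivity (\sum_sigma ((refinement_poly tau sigma)`_i *: refinement_poly sigma pi)`_j).
  by apply: eq_bigr => sigma _; rewrite coefZ.
by rewrite jE eq_sym; case: eqP => [->|_]; rewrite ?mulr1 ?mulr0.
Qed.

(** [mu] and [zeta] as matrices: entries outside the order relation, where the
    formulas are meaningless, are set to 0. *)
Definition mu_le tau pi : F := if osp_le tau pi then mu F tau pi else 0.
Definition zeta_le tau pi : F := if osp_le tau pi then zeta F tau pi else 0.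

Lemma mu_prod tau pi : osp_le tau pi ->
  mu F tau pi = \prod_(j < size pi)
    ((-1) ^+ (nblocks_in tau (nth set0 pi j)).-1 /
     (nblocks_in tau (nth set0 pi j))%:R).
Proof.
move=> le_tp; rewrite big_split /= prodfV /mu (big_nth set0) big_mkord.
congr (_ * _); rewrite prodrXr; congr (_ ^+ _).
rewrite -(sum_nblocks_in le_tp) -[X in (_ - X)%N]card_ord -sum1_card -sumnB //.
  by apply: eq_bigr => j _; rewrite subn1.
by move=> j _; exact: nblocks_in_gt0.
Qed.

Lemma mu_refl pi : mu F pi pi = 1.
Proof.
rewrite mu_prod ?osp_le_refl // big1 // => j _.
by rewrite nblocks_in_eq1 ?osp_le_refl // divr1.
Qed.

Lemma coef_refinement_poly_mu tau pi :
  (refinement_poly tau pi)`_(size pi) = mu_le tau pi.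
Proof.
rewrite /refinement_poly /mu_le; case: ifP => le_tp; last by rewrite coef0.
pose k j := nblocks_in tau (nth set0 pi j).
have /choice[q qP] (j : 'I_(size pi)) : exists q : {poly F},
    binomial_poly F (k j) = 'X * q /\ q`_0 = (-1) ^+ (k j).-1 / (k j)%:R.
  by have [q] := binomial_poly_mulX char0 (nblocks_in_gt0 j le_tp); exists q.
under eq_bigr => j _ do rewrite (qP j).1.
rewrite big_split /= prodr_const card_ord coefXnM ltnn subnn coef0_prod.
by rewrite mu_prod //; apply: eq_bigr => j _; rewrite (qP j).2.
Qed.

Lemma coef_refinement_poly_zeta tau pi :
  (refinement_poly tau pi)`_(size tau) = zeta_le tau pi.
Proof.
rewrite /refinement_poly /zeta_le; case: ifP => le_tp; last by rewrite coef0.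
rewrite /zeta (big_nth set0) big_mkord -prodfV.
have sz : size (\prod_(j < size pi) binomial_poly F (nblocks_in tau (nth set0 pi j)))
    = (size tau).+1.
  rewrite size_prod => [|j _]; last by rewrite -size_poly_eq0 size_binomial_poly.
  under eq_bigr => j _ do rewrite size_binomial_poly // -addn1.
  by rewrite big_split /= sum_nblocks_in // sum1_card -addSn addnK.
have -> : size tau = (size (\prod_(j < size pi)
    binomial_poly F (nblocks_in tau (nth set0 pi j)))).-1 by rewrite sz.
rewrite -[LHS]/(lead_coef _) lead_coef_prod.
by apply: eq_bigr => j _; rewrite lead_coef_binomial_poly.
Qed.

(** The entry is a product of the coefficient matrices with indices [size tau]
    and [size pi], so it vanishes unless these agree. *)
Lemma zeta_mu tau pi :
  \sum_sigma zeta_le tau sigma * mu_le sigma pi = (tau == pi)%:R.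
Proof.
under eq_bigr => sigma _ do rewrite -coef_refinement_poly_zeta -coef_refinement_poly_mu.
rewrite coef_refinement_polyM; have [<-|neq_tp] := eqVneq tau pi.
  by rewrite eqxx coef_refinement_poly_mu /mu_le osp_le_refl mu_refl.
case: eqP => // eq_sz; rewrite /refinement_poly ifN ?coef0 //.
by apply: contra neq_tp => le_tp; rewrite (osp_le_size_eq le_tp).
Qed.

(** A one-sided inverse of a square matrix is two-sided. *)
Lemma mu_zeta tau pi :
  \sum_sigma mu_le tau sigma * zeta_le sigma pi = (tau == pi)%:R.
Proof.
pose mx (f : osp n -> osp n -> F) : 'M[F]_#|{: osp n}| :=
  \matrix_(i, j) f (enum_val i) (enum_val j).
have mxM f g i j : (mx f *m mx g) i j =
    \sum_sigma f (enum_val i) sigma * g sigma (enum_val j).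
  rewrite mxE [RHS](reindex (@enum_val _ {: osp n})) /=; last first.
    by exists enum_rank => x _; rewrite ?enum_valK ?enum_rankK.
  by apply: eq_bigr => k _; rewrite !mxE.
have : mx zeta_le *m mx mu_le = 1%:M.
  apply/matrixP => i j; rewrite mxM zeta_mu !mxE.
  by rewrite (inj_eq enum_val_inj).
move=> /mulmx1C/matrixP/(_ (enum_rank tau) (enum_rank pi)).
by rewrite mxM !enum_rankK mxE (inj_eq enum_rank_inj).
Qed.

Lemma moebius_inversion (V : lmodType F) (f k : osp n -> V) :
  (forall pi, k pi = \sum_(sigma | osp_le sigma pi) mu F sigma pi *: f sigma) ->
  forall pi, f pi = \sum_(sigma | osp_le sigma pi) zeta F sigma pi *: k sigma.
Proof.
move=> kE pi.
transitivity (\sum_sigma (\sum_rho mu_le sigma rho * zeta_le rho pi) *: f sigma).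
  rewrite (bigD1 pi) //= mu_zeta eqxx scale1r big1 ?addr0 // => sigma nsp.
  by rewrite mu_zeta (negbTE nsp) scale0r.
under eq_bigr => sigma _ do rewrite scaler_suml.
rewrite exchange_big [RHS]big_mkcond /=; apply: eq_bigr => rho _.
rewrite kE /mu_le /zeta_le; case: ifP => le_rp; last first.
  by rewrite big1 // => sigma _; rewrite mulr0 scale0r.
rewrite scaler_sumr [RHS]big_mkcond /=; apply: eq_bigr => sigma _.
by case: ifP => _; rewrite ?mul0r ?scale0r // mulrC scalerA.
Qed.

End Moebius.

(** * Cumulants *)

Section CumulantFormula.
Set Implicit Arguments.
Unset Strict Implicit.
Variables (F : fieldType) (char0 : [pchar F] =i pred0).
Variables (A B : assocAlgType F) (phi : {linear A -> B}).
Variables (S : spreadability_system phi) (n : nat) (X : 'I_n -> A).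
Implicit Types pi sigma tau eta : osp n.

(** Sort the terms of the sum by the quasi-meet that they produce. *)
Lemma phi_dot_binomial pi (N : 'I_(size pi) -> nat) :
  phi_dot S pi (fun k => N (osp_idx pi k)) X =
  \sum_(sigma | osp_le sigma pi)
    (\prod_j 'C(N j, nblocks_in sigma (nth set0 pi j))%:R) *: phi_osp S sigma X.
Proof.
rewrite /phi_dot (partition_big
  (fun i : {dffun forall k : 'I_n, 'I_(N (osp_idx pi k))} =>
     osp_qmeet pi (okernel (fun k => (i k : nat).+1))) xpredT) //=.
rewrite [RHS]big_mkcond; apply: eq_bigr => sigma _.
rewrite (eq_bigr (fun=> phi_osp S sigma X)) => [|i /eqP i_sigma]; last first.
  by rewrite /phi_copies i_sigma.
rewrite sumr_const -cardsE card_qmeet_ker.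
by case: ifP => _; rewrite ?mulr0n // -natr_prod scaler_nat.
Qed.

Lemma cumulantE pi :
  cumulant S pi X = \sum_(sigma | osp_le sigma pi) mu F sigma pi *: phi_osp S sigma X.
Proof.
set k := fun sigma (j : 'I_(size pi)) => nblocks_in sigma (nth set0 pi j).
apply: xget_subset1 => [|b b']; last exact: (multilinear_coef_uniq char0).
pose c (m : {ffun 'I_(size pi) -> 'I_n.+2}) := \sum_(sigma | osp_le sigma pi)
  (\prod_j (binomial_poly F (k sigma j))`_(m j)) *: phi_osp S sigma X.
(* Degree [n.+1] suffices as [sigma] has at most [n] blocks. *)
exists n, c; split => [N|]; last first.
  apply: eq_bigr => sigma le_sp; rewrite mu_prod //; congr (_ *: _).
  apply: eq_bigr => j _; rewrite ffunE inordK //.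
  have [q -> <-] := binomial_poly_mulX char0 (nblocks_in_gt0 j le_sp).
  by rewrite coefXM.
rewrite phi_dot_binomial /c.
under [RHS]eq_bigr => m _ do rewrite scaler_sumr.
rewrite exchange_big /=; apply: eq_bigr => sigma _.
under [RHS]eq_bigr => m _ do rewrite scalerA -big_split /=.
rewrite -scaler_suml; congr (_ *: _).
rewrite -(bigA_distr_bigA (fun j (i : 'I_n.+2) =>
  (N j)%:R ^+ i * (binomial_poly F (k sigma j))`_i)).
apply: eq_bigr => j _; rewrite -(horner_binomial_poly char0).
have sz : (size (binomial_poly F (k sigma j)) <= n.+2)%N.
  rewrite size_binomial_poly // !ltnS (leq_trans _ (leqnSn n)) //.
  exact: leq_trans (count_size _ _) (size_osp sigma).
by rewrite (horner_coef_wide _ sz); apply: eq_bigr => i _; rewrite mulrC.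
Qed.

(** [goldberg] is [zeta] times [weisner], and summing [zeta] against the cumulants
    gives back the partitioned moments. *)
Lemma sum_goldberg_cumulant eta pi :
  \sum_(tau | osp_le tau pi) goldberg F tau eta pi *: cumulant S tau X =
  \sum_(sigma | osp_le sigma pi) mu F sigma pi *: phi_osp S (osp_qmeet sigma eta) X.
Proof.
have w0 tau : ~~ osp_le tau pi -> weisner F tau eta pi = 0.
  move=> nle; rewrite /weisner big1 // => sigma /andP[/eqP eq_tau le_sp].
  case/negP: nle; rewrite -eq_tau; exact: osp_le_trans (osp_qmeet_lel _ _) le_sp.
transitivity (\sum_tau goldberg F tau eta pi *: cumulant S tau X).
  rewrite [LHS]big_mkcond; apply: eq_bigr => tau _; case: ifP => // nle_tp.
  rewrite /goldberg big1 ?scale0r // => sigma le_ts; rewrite w0 ?mulr0 //.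
  by apply: contraFN nle_tp; exact: osp_le_trans.
transitivity (\sum_tau weisner F tau eta pi *: phi_osp S tau X).
  under [RHS]eq_bigr => sigma _ do
    rewrite (moebius_inversion char0 cumulantE) scaler_sumr.
  rewrite (exchange_big_dep xpredT) //=; apply: eq_bigr => tau _.
  rewrite scaler_suml; apply: eq_bigr => sigma _.
  by rewrite scalerA mulrC.
rewrite [RHS](partition_big (fun sigma => osp_qmeet sigma eta) xpredT) //=.
apply: eq_bigr => tau _; rewrite scaler_suml.
apply: eq_big => [sigma|sigma /andP[/eqP-> _]] //.
by rewrite andbC.
Qed.

(** Only the partition has to vary: at fixed [X] and [eta] the two families of
    equations are obtained from each other by an invertible linear
    transformation. *)
Lemma cumulant_goldbergP eta :
  (forall pi, phi_osp S pi X = phi_osp S (osp_qmeet pi eta) X) <->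
  (forall pi, cumulant S pi X -
     \sum_(tau | osp_le tau pi) goldberg F tau eta pi *: cumulant S tau X = 0).
Proof.
pose delta pi := phi_osp S pi X - phi_osp S (osp_qmeet pi eta) X.
have deltaE pi : cumulant S pi X -
    \sum_(tau | osp_le tau pi) goldberg F tau eta pi *: cumulant S tau X =
    \sum_(sigma | osp_le sigma pi) mu F sigma pi *: delta sigma.
  rewrite sum_goldberg_cumulant cumulantE -sumrB.
  by apply: eq_bigr => sigma _; rewrite scalerBr.
split=> [ind pi | K0 pi].
  by rewrite deltaE big1 // => sigma _; rewrite /delta -ind subrr scaler0.
have K0' rho : 0 = \sum_(sigma | osp_le sigma rho) mu F sigma rho *: delta sigma.
  by rewrite -deltaE K0.
apply/eqP; rewrite -subr_eq0 -/(delta pi) (moebius_inversion char0 K0').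
by rewrite big1 // => sigma _; rewrite scaler0.
Qed.

End CumulantFormula.

Theorem theorem5p6 (R : realType) (A B : assocAlgType R[i])
    (phi : {linear A -> B}) (S : spreadability_system phi)
    (I : set nat) (I_pos : forall j, I j -> (0 < j)%N)
    (D : nat -> set A) (D_sub : forall j, I j -> is_subalgebra (D j)) :
  spr_independent S I D <->
  (forall n, (0 < n)%N ->
   forall (i : 'I_n -> nat) (X : 'I_n -> A) (pi : osp n),
     (forall k, I (i k)) -> (forall k, D (i k) (X k)) ->
     cumulant S pi X
     - \sum_(tau : osp n | osp_le tau pi)
         goldberg R[i] tau (okernel i) pi *: cumulant S tau X = 0).
Proof.
have char0 : [pchar R[i]] =i pred0 := Num.Theory.pchar_num _.
split=> eqs n n_gt0 i X pi Ii Xi.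
- by apply: ((cumulant_goldbergP char0 S X (okernel i)).1 _ pi) => sigma; exact: eqs.
- by apply: ((cumulant_goldbergP char0 S X (okernel i)).2 _ pi) => sigma; exact: eqs.
Qed.
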